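(* Let $G$ be a skew left brace, $E$ a trivial left semi-brace, $\alpha:(E,\circ)\to\mathrm{Aut}(G,+,\circ)$ a homomorphism, and let $B:=G\rtimes_\alpha E$ be the semidirect product of left semi-braces. Then $B$ is right nilpotent if and only if $\alpha_e=\mathrm{id}_G$ for all $e\in E$ and $G$ is right nilpotent.
   Context: A left semi-brace is a triple $(B,+,\circ)$ where $(B,+)$ is a semigroup, $(B,\circ)$ is a group and $a\circ(b+c)=a\circ b+a\circ(a^-+c)$ for all $a,b,c\in B$, where $a^-$ is the inverse of $a$ in $(B,\circ)$ and $\circ$ has higher precedence than $+$. It is left cancellative if $(B,+)$ is left cancellative. The neutral element of $(B,\circ)$ is denoted by $0$. A skew left brace is a left semi-brace for which $(B,+)$ is a (not necessarily abelian) group. The trivial left semi-brace on a group $(E,\circ)$ is given by $a+b:=b$. Semidirect product: $G\rtimes_\alpha E$ is the set $G\times E$ with $(g_1,e_1)+(g_2,e_2):=(g_1+g_2,e_1+e_2)=(g_1+g_2,e_2)$ and $(g_1,e_1)\circ(g_2,e_2):=(g_1\circ\alpha_{e_1}(g_2),e_1\circ e_2)$; it is a left cancellative left semi-brace. Right nilpotency: for a left cancellative left semi-brace $B$, let $G_B:=B+0$ (a subgroup of $(B,\circ)$ which is a skew left brace) and $E_B$ the set of idempotents of $(B,+)$. For $B=G\rtimes_\alpha E$ these are $G\times\{0\}$ and $\{0\}\times E$, respectively. Put $\lambda_a(b):=a\circ(a^-+b)$ and $a\cdot b:=\lambda_a(a^-)+a\circ b+\lambda_b(b^-)$ for $a,b\in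 B$; one has $a\cdot b\in G_B$. For subsets $X,Y\subseteq B$ let $X\cdot Y$ be the additive subgroup of $(G_B,+)$ generated by the elements $a\cdot b$ with $a\in X$, $b\in Y$. Define $B^{(1)}:=B$ and $B^{(n+1)}:=B^{(n)}\cdot B+E_B$ for $n\geq 1$. $B$ is right nilpotent if $B^{(n)}=E_B$ for some $n\in\mathbb{N}$. (For a skew left brace $G$, the set of additive idempotents is $\{0\}$ and $a\cdot b=-a+a\circ b-b$.) *)

(* Defs.v *)
From HB Require Import structures.
From mathcomp Require Import all_boot.
From mathcomp Require Import classical_sets.

Set Implicit Arguments.
Unset Strict Implicit.
Unset Printing Implicit Defensive.

Declare Scope semibrace_scope.
Delimit Scope semibrace_scope with SB.

(* The group law of a left semi-brace is the (multiplicative) group law of its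
   [groupType] structure, and the neutral element of that group, usually
   written 0, is [1%g].  The addition is the bare [add] of a
   [baseAddMagmaType], without commutativity or a zero. *)
Notation "x ∘ y" := (x * y)%g (at level 40, left associativity)
  : semibrace_scope.
Notation "x + y" := (Algebra.add x y) : semibrace_scope.
Notation "x ^-1" := (x^-1)%g : semibrace_scope.

Local Open Scope classical_set_scope.
Local Open Scope semibrace_scope.

HB.mixin Record isLeftSemiBrace B of Group B & Algebra.BaseAddMagma B := {
  sb_addA : associative (fun a b : B => a + b);
  sb_circD : forall a b c : B, a ∘ (b + c) = a ∘ b + a ∘ (a^-1 + c)
}.

#[short(type="leftSemiBraceType")]
HB.structure Definition LeftSemiBrace :=
  {B of Group B & Algebra.BaseAddMagma B & isLeftSemiBrace B}.

HB.mixin Record isLeftCancellative B of Algebra.BaseAddMagma B := {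
  sb_addI : forall a b c : B, a + b = a + c -> b = c
}.

#[short(type="lcLeftSemiBraceType")]
HB.structure Definition LCLeftSemiBrace :=
  {B of LeftSemiBrace B & isLeftCancellative B}.

HB.mixin Record isAdditiveGroup B of Algebra.BaseAddMagma B := {
  sb_zero : B;
  sb_opp : B -> B;
  sb_add0 : left_id sb_zero (fun a b : B => a + b);
  sb_addr0 : right_id sb_zero (fun a b : B => a + b);
  sb_addN : left_inverse sb_zero sb_opp (fun a b : B => a + b);
  sb_addrN : right_inverse sb_zero sb_opp (fun a b : B => a + b)
}.

#[short(type="skewLeftBraceType")]
HB.structure Definition SkewLeftBrace :=
  {B of LCLeftSemiBrace B & isAdditiveGroup B}.

(* Left cancellativity is automatic when (B, +) is a group. *)
HB.factory Record LeftSemiBrace_isSkewLeftBrace B of LeftSemiBrace B := {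
  zero : B;
  opp : B -> B;
  add0 : left_id zero (fun a b : B => a + b);
  addr0 : right_id zero (fun a b : B => a + b);
  addN : left_inverse zero opp (fun a b : B => a + b);
  addrN : right_inverse zero opp (fun a b : B => a + b)
}.

HB.builders Context B of LeftSemiBrace_isSkewLeftBrace B.
Fact addI (a b c : B) : a + b = a + c -> b = c.
Proof.
by move=> /(congr1 (fun x => opp a + x)); rewrite !sb_addA addN !add0.
Qed.
HB.instance Definition _ := isLeftCancellative.Build B addI.
HB.instance Definition _ := isAdditiveGroup.Build B add0 addr0 addN addrN.
HB.end.

Definition trivial_semibrace (E : groupType) : Type := E.

Section TrivialSemiBrace.
Variable E : groupType.
Local Notation T := (trivial_semibrace E).

HB.instance Definition _ := Group.copy T E.
HB.instance Definition _ := Algebra.hasAdd.Build T (fun _ b => b).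

Fact triv_addA : associative (fun a b : T => a + b).
Proof. by []. Qed.
Fact triv_circD (a b c : T) : a ∘ (b + c) = a ∘ b + a ∘ (a^-1 + c).
Proof. by []. Qed.
Fact triv_addI (a b c : T) : a + b = a + c -> b = c.
Proof. by []. Qed.

HB.instance Definition _ := isLeftSemiBrace.Build T triv_addA triv_circD.
HB.instance Definition _ := isLeftCancellative.Build T triv_addI.
End TrivialSemiBrace.

(* f belongs to Aut(G, +, ∘) *)
Definition semibrace_aut (G : leftSemiBraceType) (f : G -> G) : Prop :=
  [/\ bijective f,
      forall x y, f (x + y) = f x + f y &
      forall x y, f (x ∘ y) = f x ∘ f y].

(* homomorphisms (E, ∘) -> Aut(G, +, ∘) *)
Record aut_hom (E G : leftSemiBraceType) := AutHom {
  aut_hom_fun :> E -> G -> G;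
  aut_homP : forall e, semibrace_aut (aut_hom_fun e);
  aut_homM : forall e f, aut_hom_fun (e ∘ f) =1 aut_hom_fun e \o aut_hom_fun f
}.

(* A new name for G * E, since pairs carry the componentwise structures. *)
Definition semidirect (G E : leftSemiBraceType) (alpha : aut_hom E G) : Type :=
  (G * E)%type.

Section Semidirect.
Variables (G E : leftSemiBraceType) (alpha : aut_hom E G).
Local Notation S := (semidirect alpha).
Implicit Types (x y z : S).

Definition sd_add x y : S := (x.1 + y.1, x.2 + y.2).
Definition sd_circ x y : S := (x.1 ∘ alpha x.2 y.1, x.2 ∘ y.2).
Definition sd_one : S := (1%g, 1%g).
Definition sd_inv x : S := (alpha x.2^-1 x.1^-1, x.2^-1).

Fact aut_homD e (g h : G) : alpha e (g + h) = alpha e g + alpha e h.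
Proof. by case: (aut_homP alpha e). Qed.
Fact aut_hom_circ e (g h : G) : alpha e (g ∘ h) = alpha e g ∘ alpha e h.
Proof. by case: (aut_homP alpha e). Qed.
Fact aut_hom_one e : alpha e 1%g = 1%g.
Proof. by apply: (mulgI (alpha e 1%g)); rewrite -aut_hom_circ !mulg1. Qed.
Fact aut_hom1 g : alpha 1%g g = g.
Proof.
have [/bij_inj injf _ _] := aut_homP alpha 1%g.
by apply: injf; rewrite -[LHS](aut_homM alpha) mulg1.
Qed.

Fact sd_circA : associative sd_circ.
Proof.
move=> x y z; rewrite /sd_circ /= aut_hom_circ !mulgA.
by rewrite (aut_homM alpha x.2 y.2 z.1).
Qed.
Fact sd_mul1 : left_id sd_one sd_circ.
Proof. by case=> g e; rewrite /sd_circ /= aut_hom1 !mul1g. Qed.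
Fact sd_mulV : left_inverse sd_one sd_inv sd_circ.
Proof.
by case=> g e; rewrite /sd_circ /= -aut_hom_circ !mulVg aut_hom_one.
Qed.
Fact sd_mulr1 : right_id sd_one sd_circ.
Proof. by case=> g e; rewrite /sd_circ /= aut_hom_one !mulg1. Qed.
Fact sd_mulrV : right_inverse sd_one sd_inv sd_circ.
Proof.
case=> g e; rewrite /sd_circ /= -[alpha e _](aut_homM alpha e e^-1 g^-1).
by rewrite !mulgV aut_hom1 mulgV.
Qed.

HB.instance Definition _ := Choice.copy S (G * E)%type.
HB.instance Definition _ :=
  isGroup.Build S sd_circA sd_mul1 sd_mulr1 sd_mulV sd_mulrV.
HB.instance Definition _ := Algebra.hasAdd.Build S sd_add.

Fact sd_addA : associative (fun x y => x + y).
Proof. by move=> x y z; congr pair; rewrite /= sb_addA. Qed.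
Fact sd_circD x y z : x ∘ (y + z) = x ∘ y + x ∘ (x^-1 + z).
Proof.
congr pair => /=; last exact: sb_circD.
rewrite !aut_homD sb_circD; congr (_ + _ ∘ (_ + _)).
by rewrite -[RHS](aut_homM alpha) mulgV aut_hom1.
Qed.
HB.instance Definition _ := isLeftSemiBrace.Build S sd_addA sd_circD.
End Semidirect.

Section SemidirectLC.
Variables (G E : lcLeftSemiBraceType) (alpha : aut_hom E G).
Fact sd_addI (x y z : semidirect alpha) : x + y = x + z -> y = z.
Proof.
case: x y z => [g e] [g1 e1] [g2 e2] [] /sb_addI-> /sb_addI->.
by [].
Qed.
HB.instance Definition _ := isLeftCancellative.Build (semidirect alpha) sd_addI.
End SemidirectLC.

Section RightNilpotency.
Variable B : lcLeftSemiBraceType.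
Implicit Types (a b : B) (X Y H : set B).

Definition GB : set B := [set b + 1%g | b in [set: B]].
Definition EB : set B := [set b | b + b = b].

Definition lam a b : B := a ∘ (a^-1 + b).
Definition dot a b : B := lam a a^-1 + a ∘ b + lam b b^-1.

(* Subgroups of (GB, +), a group with neutral element 1%g. *)
Definition additive_subgroup H : Prop :=
  [/\ H `<=` GB, H 1%g,
      forall a b, H a -> H b -> H (a + b) &
      forall a, H a -> exists2 b, H b & a + b = 1%g /\ b + a = 1%g].

(* X · Y, the subgroup of (GB, +) generated by the a · b *)
Definition dot_set X Y : set B :=
  smallest additive_subgroup [set dot a b | a in X & b in Y].

(* B^(n), which is indexed from n = 1 *)
Definition right_series n : set B :=
  iter n.-1 (fun X => [set a + b | a in dot_set X [set: B] & b in EB]) [set: B].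

Definition right_nilpotent : Prop :=
  exists2 n, (0 < n)%N & right_series n = EB.

Lemma add1x a : 1%g + a = a.
Proof.
apply: (@sb_addI _ a); have := sb_circD 1%g a a.
by rewrite !mul1g invg1.
Qed.

Lemma GBE a : GB a <-> a + 1%g = a.
Proof.
split=> [[b _ <-]|<-]; last by exists a.
by rewrite -sb_addA add1x.
Qed.

Lemma add_lamV a : a + lam a a^-1 = 1%g.
Proof. by have := sb_circD a 1%g a^-1; rewrite add1x mulgV mulg1. Qed.

Lemma dot_GB a b : GB (dot a b).
Proof.
apply/GBE; rewrite /dot -sb_addA; congr (_ + _).
by apply: (@sb_addI _ b); rewrite sb_addA add_lamV add1x.
Qed.

(* so [dot_set] is not an empty intersection *)
Lemma GB_subgroup : additive_subgroup GB.
Proof.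
have lamV_GB a : GB (lam a a^-1).
  by apply/GBE; apply: (@sb_addI _ a); rewrite sb_addA add_lamV add1x.
split=> //.
- by apply/GBE; rewrite add1x.
- by move=> a b _ /GBE b0; apply/GBE; rewrite -sb_addA b0.
move=> a /GBE a0; exists (lam a a^-1) => //; split; first exact: add_lamV.
have /GBE l0 := lamV_GB a.
apply: (@sb_addI _ a); by rewrite sb_addA add_lamV add1x a0.
Qed.

End RightNilpotency.

Lemma skew_zeroE (G : skewLeftBraceType) : @sb_zero G = 1%g.
Proof. by rewrite -[RHS](@sb_addr0 G) add1x. Qed.

(* Main.v *)
Require Import Defs.
From HB Require Import structures.
From mathcomp Require Import all_boot.
From mathcomp Require Import classical_sets.

(** For [a = (g, e)] and [b = (h, f)] one computes
    [a · b = (- g + g ∘ α_e(h) - h, 0)].  Every [B^(n)] contains [{0} × E], so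
    [B^(n+1)] contains all [(α_e(h) - h, 0)]; the series being decreasing, right
    nilpotency forces [α = id].  When [α = id], [a · b = (g · h, 0)], hence
    [B^(n) = G^(n) × E]. *)

Set Implicit Arguments.
Unset Strict Implicit.
Unset Printing Implicit Defensive.

Local Open Scope classical_set_scope.
Local Open Scope semibrace_scope.

Section RightSeries.
Variable B : lcLeftSemiBraceType.
Implicit Types (a b : B) (X Y H : set B).

Lemma EB1 : EB (1%g : B).
Proof. exact: add1x. Qed.

Lemma dot_setS X X' Y : X `<=` X' -> dot_set X Y `<=` dot_set X' Y.
Proof.
move=> sXX' c Xc H [Hsub Hgen]; apply: Xc; split=> // d [a Xa [b Yb <-]].
by apply: Hgen; exists a; [exact: sXX' | exists b].
Qed.

Lemma dot_in_dot_set X Y a b : X a -> Y b -> dot_set X Y (dot a b).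
Proof. by move=> Xa Yb H [_ Hgen]; apply: Hgen; exists a => //; exists b. Qed.

(** This is an intersection of subgroups. [GB] is one of them: it bounds the intersection and
    supplies the inverses. *)
Lemma dot_set_subgroup X Y : additive_subgroup (dot_set X Y).
Proof.
have sGB : dot_set X Y `<=` GB (B := B).
  move=> c; apply; split; first exact: GB_subgroup.
  by move=> d [a _ [b _ <-]]; exact: dot_GB.
split=> //.
- by move=> H [[]].
- move=> a b Xa Xb H HP; have [[_ _ HD _] _] := HP.
  by apply: HD; [exact: Xa | exact: Xb].
- move=> a Xa; have [_ _ _ /(_ a (sGB a Xa))[b _ [ab ba]]] := GB_subgroup B.
  exists b => // H HP; have [[_ _ _ HN] _] := HP.
  (* Each [H] has its own inverse [c] of [a]; left cancellation identifies it with [b], so one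
     inverse serves every [H]. *)
  have [c Hc [ac _]] := HN a (Xa H HP).
  by rewrite (@sb_addI _ a b c) // ab ac.
Qed.

Lemma right_seriesS n : right_series (B := B) n.+2 =
  [set a + b | a in dot_set (right_series n.+1) [set: B] & b in EB (B := B)].
Proof. by []. Qed.

(** Monotonicity of [dot_set] in its first argument propagates the first inclusion, which is trivial
    because the series starts at the whole of [B]. *)
Lemma right_series_decr n :
  right_series (B := B) n.+2 `<=` right_series (B := B) n.+1.
Proof.
elim: n => [|n IHn] // c; rewrite right_seriesS => -[a Xa [b Eb <-]].
by rewrite right_seriesS; exists a; [exact: dot_setS Xa | exists b].
Qed.

Lemma EB_sub_right_series n : EB (B := B) `<=` right_series n.+1.
Proof.
case: n => [|n] // b Eb; rewrite right_seriesS; exists 1%g.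
  by case: (dot_set_subgroup (right_series n.+1) [set: B]).
by exists b => //; rewrite add1x.
Qed.

Lemma dot_right_series n a b :
  right_series n.+1 a -> right_series (B := B) n.+2 (dot a b).
Proof.
move=> Xa; rewrite right_seriesS; exists (dot a b); first exact: dot_in_dot_set.
by exists 1%g; [exact: EB1 | apply/GBE; exact: dot_GB].
Qed.

End RightSeries.

Section SkewLeftBrace.
Variable G : skewLeftBraceType.
Implicit Types g h k : G.

Lemma skew_addr1 g : g + 1%g = g.
Proof. by rewrite -skew_zeroE sb_addr0. Qed.

Lemma skew_addIr k g h : g + k = h + k -> g = h.
Proof.
move=> /(congr1 (fun x => x + sb_opp k)).
by rewrite -!sb_addA sb_addrN !sb_addr0.
Qed.

Lemma skew_EBE g : EB g <-> g = 1%g.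
Proof.
split=> [gg|->]; last exact: EB1.
by apply: (@sb_addI _ g); rewrite skew_addr1.
Qed.

End SkewLeftBrace.

Section SemidirectSkew.
Variables (G : skewLeftBraceType) (E : groupType).
Variable alpha : aut_hom (trivial_semibrace E) G.
Local Notation B := (semidirect alpha).
Implicit Types (g h : G) (x y : B).

Lemma sd_EBE x : EB x <-> x.1 = 1%g.
Proof.
case: x => g e; rewrite /= -skew_EBE; split=> [[]|gg] //.
by congr pair.
Qed.

(** In [lam z z^-1] the twist by [alpha] inside [z^-1] is undone by the outer product. The second
    coordinate of a sum is that of its last summand, here [y.2 ∘ y.2^-1]. *)
Lemma sd_dotE x y : dot x y =
  (lam x.1 x.1^-1 + x.1 ∘ alpha x.2 y.1 + lam y.1 y.1^-1, 1%g) :> B.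
Proof.
have lamV (z : B) : lam z z^-1 = (lam z.1 z.1^-1, 1%g).
  congr pair; last exact: (mulgV z.2).
  rewrite /= aut_homD -[alpha z.2 (alpha _ _)](aut_homM alpha).
  by rewrite mulgV aut_hom1.
by rewrite /dot !lamV.
Qed.

Lemma right_nilpotent_aut_id :
  right_nilpotent B -> forall e, alpha e =1 id.
Proof.
move=> [[|n] // _ Bn] e h.
have E1e : right_series n.+1 ((1%g, e) : B).
  by apply: EB_sub_right_series; apply/sd_EBE.
(* The product of [(1, e)] and [(h, 1)] has first coordinate [alpha e h - h], with [lam h h^-1] as
   [- h]. It lies in the next term of the series, hence also in the current one, which is [EB]. *)
have := right_series_decr (dot_right_series ((h, 1%g) : B) E1e).
rewrite Bn sd_EBE sd_dotE /= => dot1.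
apply: (@skew_addIr _ (lam h h^-1)); rewrite add_lamV -[RHS]dot1.
by rewrite /lam invg1 !mul1g !add1x.
Qed.

Hypothesis alpha_id : forall e, alpha e =1 id.

Lemma sd_dot_id x y : dot x y = (dot x.1 y.1, 1%g) :> B.
Proof. by rewrite sd_dotE alpha_id. Qed.

Lemma sd_dot_set (X : set G) :
  dot_set [set x : B | X x.1] [set: B] =
  [set x : B | dot_set X [set: G] x.1 /\ x.2 = 1%g].
Proof.
have [sG G1 GD GN] := dot_set_subgroup X [set: G].
have [sB B1 BD BN] := dot_set_subgroup [set x : B | X x.1] [set: B].
apply/seteqP; split=> [x|[g _] [/= Xg ->]].
(* By minimality, it suffices that the right-hand side is a subgroup containing the generators. *)
- apply; split; last first.
    move=> _ [y Xy [z _ <-]]; rewrite sd_dot_id; split=> //=.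
    exact: dot_in_dot_set.
  split=> //.
  + by move=> [g _] [_ /= ->]; apply/GBE; congr pair; exact: skew_addr1.
  + by move=> [g _] [h _] [/= Xg ->] [/= Xh ->]; split=> //=; exact: GD.
  + move=> [g _] [/= Xg ->]; have [h Xh [gh hg]] := GN g Xg.
    by exists (h, 1%g) => //; split; congr pair.
(* Conversely, minimality in [G] is applied to the preimage of the subgroup under [g ↦ (g, 1)]. *)
- pose H := [set h | dot_set [set x : B | X x.1] [set: B] (h, 1%g)].
  apply: (Xg H); split; last first.
    move=> _ [h Xh [k _ <-]]; rewrite /H /=.
    rewrite -(sd_dot_id (h, 1%g) (k, 1%g)).
    exact: dot_in_dot_set.
  split=> //.
  + by move=> h _; apply/GBE; exact: skew_addr1.
  + by move=> h k; exact: BD.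
  (* The second coordinate of [(h, 1) + (k, e)] is [e], so the inverse has [e = 1]. *)
  + move=> h /BN[[k e] Xk [[hk e1] [kh]]].
    by exists k => //; rewrite /H /= -e1.
Qed.

(** Adding [EB], which is [{1} × E] in the semidirect product and [{1}] in [G], frees the second
    coordinate and leaves the first unchanged. *)
Lemma sd_right_series n :
  right_series n.+1 = [set x : B | right_series (B := G) n.+1 x.1].
Proof.
elim: n => [|n IHn]; first by apply/seteqP; split.
rewrite !right_seriesS IHn sd_dot_set; apply/seteqP; split.
  move=> _ [x [Xx _] [y /sd_EBE y1 <-]]; exists x.1 => //.
  by exists y.1 => //; apply/skew_EBE.
move=> [g e] /= [h Xh [k /skew_EBE-> <-]]; exists (h, 1%g) => //.
by exists (1%g, e) => //; apply/sd_EBE.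
Qed.

(** Both the series and the idempotents of the semidirect product are preimages of those of [G]
    under the first projection, so the same index works on both sides. *)
Lemma sd_right_nilpotent : right_nilpotent B <-> right_nilpotent G.
Proof.
split=> -[[|n] // _ En]; exists n.+1 => //; apply/seteqP; split.
- move=> g Gg; have : EB ((g, 1%g) : B) by rewrite -En sd_right_series.
  by move=> /sd_EBE /skew_EBE.
- exact: EB_sub_right_series.
- by move=> x; rewrite sd_right_series En /= => /skew_EBE /sd_EBE.
- exact: EB_sub_right_series.
Qed.

End SemidirectSkew.

Theorem proposition6p2 (G : skewLeftBraceType) (E : groupType)
    (alpha : aut_hom (trivial_semibrace E) G) :
  right_nilpotent (semidirect alpha) <->
  (forall e : trivial_semibrace E, alpha e =1 id) /\ right_nilpotent G.
Proof.
split=> [Bnil|[alpha_id Gnil]].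
  have alpha_id := right_nilpotent_aut_id Bnil.
  by split=> //; apply/(sd_right_nilpotent alpha_id).
exact/(sd_right_nilpotent alpha_id).
Qed.
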